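(* Let $\{V_{n]}\}_{n\in\mathbb N}$ be a compatible sequence of finite dimensional Volterra operators and let $\{\mathbf V_n\}_{n\in\mathbb N}$ be the associated sequence of operators on $S$. Then for every $m\in\mathbb N$ the sequence $\{\mathbf V_n^m\}_{n\in\mathbb N}$ of $m$-th iterates converges weakly; that is, there is a map $\mathbf W_m:S\to S$ such that $(\mathbf V_n^m(x))_k\to(\mathbf W_m(x))_k$ as $n\to\infty$ for every $x\in S$ and $k\in\mathbb N$.
   Context: $S=\{x=(x_n)_{n\in\mathbb N}\in\ell^1 : x_n\ge 0,\ \sum_{n=1}^\infty x_n=1\}$. For $n\in\mathbb N$ let $K_n=\{1,\dots,n\}$ and $S^{K_n}=\{x\in S: x_i=0\ \forall i\notin K_n\}$. A finite dimensional Volterra operator $V_{n]}:S^{K_n}\to S^{K_n}$ is one of the form $(V_{n]}(x))_k=x_k\bigl(1+\sum_{i=1}^n a^{n]}_{ki}x_i\bigr)$, $k=1,\dots,n$, where $(a^{n]}_{ki})$ is skew-symmetric with $|a^{n]}_{ki}|\le1$. The sequence $\{V_{n]}\}$ is compatible if $V_{n+1]}|_{S^{K_n}}=V_{n]}$ for every $n$ (so $a^{n+1]}_{ki}=a^{n]}_{ki}$ for $k,i\le n$). The associated operators $\mathbf V_n:S\to S$ are defined by $(\mathbf V_n(x))_k=x_k\bigl(1+\sum_{i=1}^n a^{n]}_{ki}x_i\bigr)$ for $k\le n$ and $(\mathbf V_n(x))_k=x_k$ for $k\ge n+1$. $\mathbf V_n^m$ denotes the $m$-fold composition of $\mathbf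 V_n$ with itself. *)

(* Defs.v *)
From HB Require Import structures.
From mathcomp Require Import all_boot all_order all_algebra.
From mathcomp Require Import all_classical all_reals all_analysis.

Set Implicit Arguments.
Unset Strict Implicit.
Unset Printing Implicit Defensive.

Import Order.TTheory GRing.Theory Num.Theory.
Import numFieldNormedType.Exports.

Local Open Scope classical_set_scope.
Local Open Scope ring_scope.

(* Coordinates are numbered from 0, so the index set K_n = {1, ..., n} is
   {k | k < n}. *)

(* The set S. A nonnegative sequence with convergent series is in l^1, so
   membership in l^1 needs no separate clause. *)
Definition simplex (R : realType) : set (R^nat) :=
  [set x | (forall k, 0 <= x k) /\ series x @ \oo --> (1 : R)].

(* The face S^{K_n}; it is empty for n = 0. *)
Definition face (R : realType) (n : nat) : set (R^nat) :=
  [set x | simplex x /\ forall k, (n <= k)%N -> x k = 0].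

Arguments simplex {R}.
Arguments face {R} n.

(* The data of a Volterra operator on S^{K_n}. These coefficients are uniquely
   determined by the operator [volterra_op] below (evaluate it at the midpoints
   of two vertices). *)
Record volterra (R : realType) (n : nat) := Volterra {
  coef : 'M[R]_n ;
  coef_skew : coef^T = - coef ;
  coef_bound : forall k i, `|coef k i| <= 1
}.

(* V_{n]}. Points of S^{K_n} are infinite sequences, so the coordinates outside
   K_n are set to 0. *)
Definition volterra_op (R : realType) (n : nat) (V : volterra R n) (x : R^nat)
    : R^nat := fun k =>
  if insub k is Some k' then x k * (1 + \sum_(i < n) coef V k' i * x i) else 0.

(* The associated operator on S, which fixes the coordinates outside K_n. *)
Definition volterra_ext (R : realType) (n : nat) (V : volterra R n) (x : R^nat)
    : R^nat := fun k =>
  if insub k is Some k' then x k * (1 + \sum_(i < n) coef V k' i * x i) else x k.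

Definition compatible (R : realType) (V : forall n, volterra R n) :=
  forall n (x : R^nat), face n x ->
    volterra_op (V n.+1) x = volterra_op (V n) x.

Lemma simplex_sum_le1 (R : realType) (n : nat) (x : R^nat) :
  simplex x -> \sum_(i < n) x i <= 1.
Proof.
move=> [x0 x1].
have nd : nondecreasing_seq (series x).
  by apply/nondecreasing_seqP => k; rewrite /series /= big_nat_recr //= lerDl.
have cx : cvgn (series x) by apply/cvg_ex; exists 1.
have := nondecreasing_cvgn_le nd cx n.
rewrite (_ : limn (series x) = 1); last exact: cvg_lim x1.
by rewrite /series /= big_mkord.
Qed.

Lemma volterra_ext_ge0 (R : realType) (n : nat) (V : volterra R n) x k :
  simplex x -> 0 <= volterra_ext V x k.
Proof.
move=> Sx; have [x0 _] := Sx; rewrite /volterra_ext.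
case: insubP => [k' _ _|_] //; apply: mulr_ge0 => //.
rewrite -[X in _ + X]opprK subr_ge0 -sumrN.
apply: le_trans (simplex_sum_le1 n Sx); apply: ler_sum => i _.
rewrite -mulNr ler_piMl //.
by apply: le_trans (coef_bound V k' i); rewrite -normrN ler_norm.
Qed.

Lemma volterra_ext_sum (R : realType) (n : nat) (V : volterra R n) x :
  \sum_(k < n) volterra_ext V x k = \sum_(k < n) x k.
Proof.
have -> : \sum_(k < n) volterra_ext V x k
    = \sum_(k < n) x k + \sum_(k < n) \sum_(i < n) x k * (coef V k i * x i).
  rewrite -big_split /=; apply: eq_bigr => k _.
  by rewrite /volterra_ext valK mulrDr mulr1 mulr_sumr.
set s := \sum_(k < n) \sum_(i < n) _.
suff : s = - s.
  by move/eqP; rewrite -subr_eq0 opprK -mulr2n mulrn_eq0 => /eqP ->; rewrite addr0.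
rewrite {1}/s exchange_big /= /s -sumrN; apply: eq_bigr => k _.
rewrite -sumrN; apply: eq_bigr => i _.
have -> : coef V i k = - coef V k i.
  by have /matrixP/(_ k i) := coef_skew V; rewrite !mxE.
by rewrite mulNr mulrN mulrCA [x k * _]mulrC mulrA.
Qed.

Lemma volterra_ext_simplex (R : realType) (n : nat) (V : volterra R n) :
  set_fun simplex simplex (volterra_ext V).
Proof.
move=> x Sx; split=> [k|]; first exact: volterra_ext_ge0.
have [_ x1] := Sx; apply: cvg_trans x1; apply: near_eq_cvg.
exists n => // N /= nN; rewrite /series /=.
rewrite !(@big_cat_nat _ _ _ n 0 N) //= !big_mkord volterra_ext_sum.
congr (_ + _); apply: eq_big_nat => k /andP[nk _].
by rewrite /volterra_ext insubF // ltnNge nk.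
Qed.

Lemma volterra_op_face (R : realType) (n : nat) (V : volterra R n) :
  set_fun (face n) (face n) (volterra_op V).
Proof.
move=> x [Sx x0].
have -> : volterra_op V x = volterra_ext V x.
  apply/funext => k; rewrite /volterra_op /volterra_ext.
  by case: insubP => // nk; rewrite x0 // leqNgt.
split; first exact: volterra_ext_simplex.
by move=> k nk; rewrite /volterra_ext insubF ?x0 // ltnNge nk.
Qed.

HB.instance Definition _ (R : realType) (n : nat) (V : volterra R n) :=
  isFun.Build _ _ (face n) (face n) (volterra_op V) (@volterra_op_face R n V).

HB.instance Definition _ (R : realType) (n : nat) (V : volterra R n) :=
  isFun.Build _ _ simplex simplex (volterra_ext V) (@volterra_ext_simplex R n V).

(* Main.v *)
(** The sum in each coordinate of V_n lies in [-1, 1], so V_n at most doubles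
    every coordinate, and the m-th iterates at x are dominated by
    2^m x uniformly in n. Compatibility makes each coefficient a_ki eventually
    independent of n, so Tannery's theorem (dominated convergence for sums)
    passes to the limit in V_n^(m+1) = V_n o V_n^m coordinate by coordinate.
    Since V_n preserves the sum of the first n coordinates, a second use of
    Tannery's theorem shows that no mass escapes: the limit is again in S. *)
Require Import Defs.
From HB Require Import structures.
From mathcomp Require Import all_boot all_order all_algebra.
From mathcomp Require Import all_classical all_reals all_analysis.
From mathcomp Require Import lra.
Set Implicit Arguments.
Unset Strict Implicit.
Unset Printing Implicit Defensive.

Import Order.TTheory GRing.Theory Num.Theory.
Import numFieldNormedType.Exports.
Local Open Scope classical_set_scope.
Local Open Scope ring_scope.

(** Cut the sum of [f n i - g i] at a fixed [N] beyond which blocks of [series b] are small. The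
    head is a finite sum of null sequences. The tail is at most twice a block of [b], since [b i]
    bounds both [f n i] and [g i] in absolute value. *)
Lemma tannery (R : realType) (f : nat -> R^nat) (g b : R^nat) :
  (forall n i, `|f n i| <= b i) -> cvgn (series b) ->
  (forall i, (fun n => f n i) @ \oo --> g i) ->
  cvgn (series g) /\ (fun n => \sum_(i < n) f n i) @ \oo --> limn (series g).
Proof.
move=> fb cb fg.
have gb i : `|g i| <= b i.
  apply: (cvgr_to_le (cvg_norm (fg i))).
  by apply: nearW => n; exact: fb.
have cg : cvgn (series g).
  apply: normed_cvg; apply: (@series_le_cvg R _ b) => // i.
    exact: normr_ge0.
  exact: le_trans (gb i).
split=> //.
suff d0 : (fun n => \sum_(i < n) (f n i - g i)) @ \oo --> (0 : R).
  rewrite -[X in _ --> X]add0r.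
  have -> : (fun n => \sum_(i < n) f n i)
      = (fun n => \sum_(i < n) (f n i - g i)) + series g.
    apply/funext => n; rewrite fctE /series /= big_mkord.
    by rewrite -big_split /=; apply: eq_bigr => i _; rewrite subrK.
  exact: cvgD.
apply/cvgrPdist_le => e e0.
(* The tail bound doubles the block of [b], so [e / 4] here leaves [e / 2] for the head. *)
have e4 : 0 < e / 4 by rewrite divr_gt0.
(* The Cauchy criterion is stated on pairs of endpoints: [N1] is the threshold for the lower end,
   [N2] for the upper end, and their maximum serves both. *)
have [[A B] /= [[N1 _ N1A] [N2 _ N2B]] AB] :=
  (cauchy_seriesP b).1 (cvg_cauchy _ cb) _ e4.
set N := maxn N1 N2.
have head0 : (fun n => \sum_(i < N) `|f n i - g i|) @ \oo --> (0 : R).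
  rewrite [X in _ --> X](_ : 0 = \sum_(i < N) (0 : R)); last by rewrite big1.
  apply: cvg_big => [|i _]; first exact: add_continuous.
  rewrite -(normr0 R) -(subrr (g i)); apply: cvg_norm.
  by apply: cvgB => //; exact: cvg_cst.
have e2 : 0 < e / 2 by rewrite divr_gt0.
near=> n.
have Nn : (N <= n)%N by near: n; exact: nbhs_infty_ge.
rewrite sub0r normrN; apply: (le_trans (ler_norm_sum _ _ _)).
rewrite -(big_mkord xpredT (fun i => `|f n i - g i|)) (big_cat_nat _ Nn) //=.
rewrite [e]splitr lerD //.
  rewrite big_mkord; apply: le_trans (ler_norm _) _.
  by near: n; exact: (cvgr0_norm_le _ head0).
have := AB (N, n); rewrite /= => /(_ _)/ltW bNn.
have {}bNn : \sum_(N <= i < n) b i <= e / 4.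
  apply: le_trans (ler_norm _) (bNn _); split.
    by apply: N1A; rewrite /= leq_maxl.
  by apply: N2B; rewrite /= (leq_trans (leq_maxr _ _) Nn).
apply: (@le_trans _ _ (2 * \sum_(N <= i < n) b i)).
  rewrite mulr_sumr; apply: ler_sum => i _.
  by rewrite mulr_natl mulr2n (le_trans (ler_normB _ _)) // lerD.
rewrite (le_trans (ler_wpM2l _ bNn)) //; lra.
Unshelve. all: by end_near. Qed.

(** Padding by zeros lets matrices of different sizes be compared at fixed indices, and merges the
    two cases of [volterra_ext] into one formula: for [k >= n] the sum vanishes. *)
Definition entry (R : realType) (n : nat) (V : volterra R n) (k i : nat) : R :=
  if insub k is Some k' then if insub i is Some i' then coef V k' i' else 0
  else 0.

Lemma entry_ord (R : realType) (n : nat) (V : volterra R n) (k i : 'I_n) :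
  entry V k i = coef V k i.
Proof. by rewrite /entry !valK. Qed.

Lemma entry_le1 (R : realType) (n : nat) (V : volterra R n) (k i : nat) :
  `|entry V k i| <= 1.
Proof.
rewrite /entry; case: insub => [k'|]; last by rewrite normr0.
by case: insub => [i'|]; [exact: coef_bound|rewrite normr0].
Qed.

Lemma volterra_extE (R : realType) (n : nat) (V : volterra R n) (x : R^nat) k :
  volterra_ext V x k = x k * (1 + \sum_(i < n) entry V k i * x i).
Proof.
rewrite /volterra_ext /entry; case: insub => [k'|].
  by congr (_ * (1 + _)); apply: eq_bigr => i _; rewrite valK.
by rewrite big1 ?addr0 ?mulr1 // => i _; rewrite mul0r.
Qed.

(* For [k = i] this is the vertex [k] itself. *)
Definition midpoint (R : realType) (k i : nat) : R^nat :=
  fun j => ((j == k)%:R + (j == i)%:R) / 2.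

Lemma sum_midpoint (R : realType) (n k i : nat) (a : nat -> R) :
  (k < n)%N -> (i < n)%N ->
  \sum_(j < n) a j * midpoint R k i j = (a k + a i) / 2.
Proof.
move=> kn in_.
have sum1 (l : nat) : (l < n)%N -> \sum_(j < n) a j * (j == l :> nat)%:R = a l.
  move=> ln; rewrite (bigD1 (Ordinal ln)) //= eqxx mulr1 big1 ?addr0 // => j jl.
  by rewrite (_ : (j == l :> nat) = false) ?mulr0 //; apply: negbTE.
rewrite -[a k]sum1 // -[a i]sum1 // -big_split /= mulr_suml.
by apply: eq_bigr => j _; rewrite mulrA mulrDr.
Qed.

Lemma midpoint_face (R : realType) (n k i : nat) :
  (k < n)%N -> (i < n)%N -> face n (midpoint R k i).
Proof.
move=> kn in_; split; last first.
  move=> j nj; rewrite /midpoint !gtn_eqF ?addr0 ?mul0r //; exact: leq_trans nj.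
split=> [j|]; first by rewrite /midpoint divr_ge0 // addr_ge0.
apply: cvg_near_cst.
exists n => // N /= nN; rewrite /series /= big_mkord.
under eq_bigr do rewrite -[midpoint _ _ _ _]mul1r.
rewrite (sum_midpoint (fun=> 1)) ?(leq_trans kn) ?(leq_trans in_) //.
by rewrite -mulr2n divff.
Qed.

(** Coordinate [k] of the operator at the midpoint of vertices [k] and [l] determines the sum of the
    entries [(k, k)] and [(k, l)]. Taking [l = k] isolates the diagonal entry, and then [l = i]
    gives the claim. *)
Lemma entry_compatible (R : realType) (V : forall n, volterra R n) n k i :
  compatible V -> (k < n)%N -> (i < n)%N ->
  entry (V n.+1) k i = entry (V n) k i.
Proof.
move=> hV kn in_.
have entry_sum l : (l < n)%N -> entry (V n.+1) k k + entry (V n.+1) k l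
    = entry (V n) k k + entry (V n) k l.
  move=> ln; have fm := midpoint_face R kn ln.
  have opE p (U : volterra R p) : (k < p)%N -> (l < p)%N ->
      volterra_op U (midpoint R k l) k = midpoint R k l k *
        (1 + (entry U k k + entry U k l) / 2).
    move=> kp lp; rewrite -(sum_midpoint _ kp lp) -volterra_extE.
    by rewrite /volterra_op /volterra_ext insubT.
  have := congr1 (fun y => y k) (hV n _ fm).
  rewrite /= !opE ?ltnS ?(ltnW kn) ?(ltnW ln) //.
  have m0 : midpoint R k l k != 0.
    by rewrite /midpoint eqxx mulf_neq0 ?invr_eq0 // -natrD pnatr_eq0.
  by move=> /(mulfI m0)/addrI/mulIf; apply; rewrite invr_eq0.
have kk : entry (V n.+1) k k = entry (V n) k k.
  have /eqP := entry_sum _ kn; rewrite -!mulr2n -subr_eq0 -mulrnBl mulrn_eq0 /=.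
  by rewrite subr_eq0 => /eqP.
by have := entry_sum _ in_; rewrite kk => /addrI.
Qed.

(** The sequence is constant from [N] on, the first size whose matrix contains both indices. *)
Lemma entry_cvg (R : realType) (V : forall n, volterra R n) k i :
  compatible V -> cvgn (fun n => entry (V n) k i).
Proof.
move=> hV; set N := (maxn k i).+1; apply/cvg_ex; exists (entry (V N) k i).
apply: cvg_near_cst.
exists N => // n /= Nn; rewrite -(subnKC Nn).
elim: (n - N)%N => [|d IH]; first by rewrite addn0.
rewrite addnS entry_compatible //; apply: (leq_trans _ (leq_addr _ _)).
  by rewrite ltnS leq_maxl.
by rewrite ltnS leq_maxr.
Qed.

Lemma volterra_ext_le2 (R : realType) (n : nat) (U : volterra R n) x k :
  simplex x -> volterra_ext U x k <= 2 * x k.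
Proof.
move=> Sx; have [x0 _] := Sx; rewrite volterra_extE mulrC ler_wpM2r //.
rewrite -[2]/(1 + 1) lerD2l; apply: le_trans (simplex_sum_le1 n Sx).
apply: ler_sum => i _; rewrite ler_piMl //.
exact: le_trans (ler_norm _) (entry_le1 _ _ _).
Qed.

Lemma iter_volterra_ext_simplex (R : realType) (n m : nat)
    (U : volterra R n) x :
  simplex x -> simplex (iter m (volterra_ext U) x).
Proof. by move=> Sx; elim: m => //= m IH; exact: volterra_ext_simplex. Qed.

Lemma iter_volterra_ext_le (R : realType) (n m : nat)
    (U : volterra R n) x k :
  simplex x -> `|iter m (volterra_ext U) x k| <= 2 ^+ m * x k.
Proof.
move=> Sx; have S m' := iter_volterra_ext_simplex m' U Sx.
rewrite ger0_norm; last by have [] := S m.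
elim: m => [|m IH] /=; first by rewrite mul1r.
by apply: (le_trans (volterra_ext_le2 _ _ (S m))); rewrite exprS -mulrA ler_pM2l.
Qed.

Lemma iter_volterra_ext_sum (R : realType) (n m : nat)
    (U : volterra R n) x :
  \sum_(k < n) iter m (volterra_ext U) x k = \sum_(k < n) x k.
Proof. by elim: m => //= m IH; rewrite volterra_ext_sum. Qed.

Lemma iter_volterra_ext_cvg (R : realType) (V : forall n, volterra R n) m x k :
  compatible V -> simplex x ->
  cvgn (fun n => iter m (volterra_ext (V n)) x k).
Proof.
(* The induction keeps [k] general: one coordinate of the next iterate involves all coordinates of
   the previous one. *)
move=> hV Sx; have [_ x1] := Sx; elim: m k => [|m IH] k /=.
  exact: is_cvg_cst.
have -> : (fun n => volterra_ext (V n) (iter m (volterra_ext (V n)) x) k)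
    = (fun n => iter m (volterra_ext (V n)) x k) * (cst 1 + fun n =>
        \sum_(i < n) entry (V n) k i * iter m (volterra_ext (V n)) x i).
  by apply/funext => n; rewrite volterra_extE.
apply: is_cvgM; first exact: IH.
apply: is_cvgD; first exact: is_cvg_cst.
apply/cvg_ex; eexists; apply: (@tannery R (fun n i => entry (V n) k i *
    iter m (volterra_ext (V n)) x i) (fun i =>
    limn (fun n => entry (V n) k i) *
    limn (fun n => iter m (volterra_ext (V n)) x i)) (2 ^+ m *: x) _ _ _).2.
- move=> n i; rewrite normrM -[leRHS]mul1r ler_pM //; first exact: entry_le1.
  exact: iter_volterra_ext_le.
- by apply: is_cvg_seriesZ; apply/cvg_ex; exists 1.
- by move=> i; apply: cvgM; [exact: entry_cvg|exact: IH].
Qed.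

Lemma lim_iter_volterra_ext_simplex (R : realType) (V : forall n, volterra R n)
    m x :
  compatible V -> simplex x ->
  simplex (fun k => limn (fun n => iter m (volterra_ext (V n)) x k)).
Proof.
move=> hV Sx; have [_ x1] := Sx; split=> [k|].
  apply: limr_ge; first exact: iter_volterra_ext_cvg.
  by apply: nearW => n; have [] := iter_volterra_ext_simplex m (V n) Sx.
have cb : cvgn (series (2 ^+ m *: x)).
  by apply: is_cvg_seriesZ; apply/cvg_ex; exists 1.
have [cvgy sumy] := tannery (fun n i => iter_volterra_ext_le m (V n) i Sx) cb
  (fun i => @iter_volterra_ext_cvg R V m x i hV Sx).
set l := limn _ in sumy.
(* The sum is cut at the index [n] of the operator itself, where the mass is conserved exactly. Its
   limit 1 must then agree with the sum of the limits. *)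
have s1 : (fun n => \sum_(i < n) iter m (volterra_ext (V n)) x i) @ \oo
    --> (1 : R).
  rewrite (_ : (fun n => _) = series x) //; apply/funext => n.
  by rewrite iter_volterra_ext_sum /series /= big_mkord.
by rewrite -(cvg_unique _ sumy s1).
Qed.

Theorem theorem6p4 (R : realType) (V : forall n, volterra R n)
    (hV : compatible V) (m : nat) (hm : (0 < m)%N) :
  exists W : {fun (@simplex R) >-> (@simplex R)},
    forall x : R^nat, simplex x -> forall k : nat,
      (fun n => iter m (volterra_ext (V n)) x k) @ \oo --> W x k.
Proof.
(* [W] is total on sequences; off the simplex [limn] may be a default value, which is harmless
   because only points of [simplex] have to land in [simplex]. *)
pose W (x : R^nat) k := limn (fun n => iter m (volterra_ext (V n)) x k).
have WS : set_fun simplex simplex W.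
  by move=> x Sx; exact: lim_iter_volterra_ext_simplex.
pose HW := isFun.Build _ _ simplex simplex W WS.
pose F : {fun (@simplex R) >-> (@simplex R)} := HB.pack W HW.
by exists F => x Sx k; exact: iter_volterra_ext_cvg.
Qed.
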